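(* Let $\lambda>-1$ and $t\in\mathbb{R}$. For the generalised octic Freud weight $\omega(x;t)=|x|^{2\lambda+1}\exp(-x^8+tx^2)$, $x\in\mathbb{R}$, the first moment is given by \begin{align*} \mu_0(t;\lambda)&=\int_{-\infty}^{\infty}|x|^{2\lambda+1}\exp(-x^8+tx^2)\,dx=\int_0^\infty s^\lambda\exp(-s^4+ts)\,ds\\ &=\tfrac14\Gamma(\tfrac14\lambda+\tfrac14)\;{}_1F_3\left(\tfrac14\lambda+\tfrac14;\tfrac14,\tfrac12,\tfrac34;(\tfrac14t)^4\right)+\tfrac14\,t\,\Gamma(\tfrac14\lambda+\tfrac12)\;{}_1F_3\left(\tfrac14\lambda+\tfrac12;\tfrac12,\tfrac34,\tfrac54;(\tfrac14t)^4\right)\\ &\quad+\tfrac18\,t^2\,\Gamma(\tfrac14\lambda+\tfrac34)\;{}_1F_3\left(\tfrac14\lambda+\tfrac34;\tfrac34,\tfrac54,\tfrac32;(\tfrac14t)^4\right)+\tfrac1{24}\,t^3\,\Gamma(\tfrac14\lambda+1)\;{}_1F_3\left(\tfrac14\lambda+1;\tfrac54,\tfrac32,\tfrac74;(\tfrac14t)^4\right). \end{align*} Further, $\varphi=\mu_0(t;\lambda)$ satisfies the fourth-order equation $$\frac{d^4\varphi}{dt^4}-\tfrac14t\frac{d\varphi}{dt}-\tfrac14(\lambda+1)\varphi=0,$$ and the first recurrence coefficient $\beta_1(t;\lambda)=\frac{d}{dt}\ln\mu_0(t;\lambda)$ satisfies the third-order equation $$\frac{d^3\beta_1}{dt^3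}+4\beta_1\frac{d^2\beta_1}{dt^2}+3\left(\frac{d\beta_1}{dt}\right)^2+6\beta_1^2\frac{d\beta_1}{dt}+\beta_1^4-\tfrac14t\beta_1=\tfrac14(\lambda+1).$$
   Context: ${}_1F_3(a_1;b_1,b_2,b_3;z)=\sum_{k=0}^\infty\frac{(a_1)_k}{(b_1)_k(b_2)_k(b_3)_k}\frac{z^k}{k!}$ is the generalised hypergeometric function, where $(a)_k=a(a+1)\cdots(a+k-1)$, $(a)_0=1$. $\beta_1$ is the coefficient in $P_{2}(x)=xP_1(x)-\beta_1P_0(x)$ for the monic polynomials orthogonal with respect to the weight. *)

(* Defs.v *)
From HB Require Import structures.
From mathcomp Require Import all_boot all_order all_algebra.
From mathcomp Require Import all_classical all_reals all_analysis.

Set Implicit Arguments.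
Unset Strict Implicit.
Unset Printing Implicit Defensive.

Import Order.TTheory GRing.Theory Num.Theory.
Import numFieldNormedType.Exports.

Local Open Scope classical_set_scope.
Local Open Scope ring_scope.

(* Euler's integral: only meaningful for 0 < a. *)
Definition Gamma {R : realType} (a : R) : R :=
  \int[@lebesgue_measure R]_(s in `[0, +oo[) (s `^ (a - 1) * expR (- s)).

Definition pochhammer {R : realType} (a : R) (k : nat) : R :=
  \prod_(i < k) (a + i%:R).

Definition hyp1F3 {R : realType} (a b1 b2 b3 z : R) : R :=
  limn (series (fun k : nat =>
    pochhammer a k /
      (pochhammer b1 k * pochhammer b2 k * pochhammer b3 k) *
    (z ^+ k / k`!%:R))).

Definition omega {R : realType} (lambda t x : R) : R :=
  `|x| `^ (2 * lambda + 1) * expR (- x ^+ 8 + t * x ^+ 2).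

Definition mu0 {R : realType} (lambda t : R) : R :=
  \int[@lebesgue_measure R]_x omega lambda t x.

(* The integrals below are extended-real, and \int f is \int f^+ - \int f^-
   with +oo - +oo = -oo, so a finite value entails absolute convergence. *)
Definition monic_orthogonal {R : realType} (w : R -> R) (P : nat -> {poly R}) :
    Prop :=
  (forall n, P n \is monic /\ size (P n) = n.+1) /\
  exists h : nat -> R, (forall n, 0 < h n) /\
    forall m n,
      (\int[@lebesgue_measure R]_x ((P m).[x] * (P n).[x] * w x)%:E =
       (if m == n then h n else 0)%:E)%E.

(* Main.v *)
(* Let phi(c, t) be the integral of s^c exp(-s^4 + t s) over the positive
   half-line. The substitution s = x^2 gives mu0(t; c) = phi(c, t). Expanding
   exp(t s) and integrating term by term (dominated convergence) yields
   phi(c, t) = sum_n phi(c + n, 0) t^n / n!, an everywhere convergent power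
   series whose derivative is phi(c + 1, t). The derivative in s of
   s^(c+1) exp(-s^4 + t s) integrates to 0, that is
     4 phi(c + 4, t) = (c + 1) phi(c, t) + t phi(c + 1, t),
   which is the fourth-order equation. At t = 0 it is also the recurrence of the
   coefficients, and since 4 phi(4 a - 1, 0) = Gamma(a) (substitution u = s^4),
   splitting the power series by n modulo 4 produces the four 1F3 series.
   Orthogonality of P_1 and P_2 to P_0 forces
   beta_1 = phi(c + 1, t) / phi(c, t), and the third-order equation is the
   fourth-order one rewritten for this logarithmic derivative. *)

Require Import Defs.
From HB Require Import structures.
From mathcomp Require Import all_boot all_order all_algebra.
From mathcomp Require Import ring lra.
From mathcomp Require Import all_classical all_reals all_analysis.
From mathcomp Require Import measurable_realfun.

Import Order.TTheory GRing.Theory Num.Theory.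
Import numFieldNormedType.Exports.

Local Open Scope classical_set_scope.
Local Open Scope ring_scope.

(** * Integration on the positive half-line *)

Section Halfline.
Context {R : realType}.
Notation mu := (@lebesgue_measure R).

(* These segments exhaust ]0, +oo[; x |-> x ^+ p.+1 maps segment_pow 0 n onto
   segment_pow p n. *)
Definition segment_pow (p n : nat) : set R :=
  `[n.+2%:R^-1 ^+ p.+1, n.+2%:R ^+ p.+1]%classic.

Lemma segment_pow_lt (p n : nat) :
  n.+2%:R^-1 ^+ p.+1 < n.+2%:R ^+ p.+1 :> R.
Proof.
rewrite ltrXn2r// ?nnegrE ?invr_ge0//.
rewrite (@lt_trans _ _ 1) ?ltr1n// invf_lt1 ?ltr1n//.
Qed.

Lemma segment_pow_gt0 (p n : nat) (s : R) : segment_pow p n s -> 0 < s.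
Proof.
rewrite /segment_pow/= in_itv/= => /andP[+ _].
by apply: lt_le_trans; rewrite exprn_gt0// invr_gt0.
Qed.

Lemma measurable_segment_pow (p n : nat) : measurable (segment_pow p n).
Proof. exact: measurable_itv. Qed.

Lemma segment_pow_homo (p : nat) :
  {homo segment_pow p : n m / (n <= m)%N >-> (n <= m)%O}.
Proof.
move=> n m nm; rewrite subsetEset => s; rewrite /segment_pow/= !in_itv/=.
move=> /andP[s1 s2]; apply/andP; split.
- apply: le_trans s1; rewrite lerXn2r// ?nnegrE ?invr_ge0// lef_pV2 ?posrE//.
  by rewrite ler_nat.
- by apply: (le_trans s2); rewrite lerXn2r// ?nnegrE// ler_nat.
Qed.

Lemma segment_pow_contains (p : nat) (s : R) : 0 < s ->
  \forall n \near \oo, segment_pow p n s.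
Proof.
move=> s0; near=> n.
(* As k <= k^(p+1) for k >= 1, it suffices that n + 2 exceeds both s and 1/s. *)
have nat_le (k : nat) : (1 <= k)%N -> k%:R <= (k%:R : R) ^+ p.+1.
  by move=> k1; rewrite ler_eXnr// ler1n.
have sn : s <= n.+2%:R ^+ p.+1.
  apply: le_trans (nat_le _ _) => //; near: n; exists (Num.trunc s) => //= m /= ms.
  rewrite (le_trans (ltW (truncnS_gt _)))// ler_nat.
  by rewrite ltnS leqW.
have sVn : s^-1 <= n.+2%:R ^+ p.+1.
  apply: le_trans (nat_le _ _) => //; near: n; exists (Num.trunc s^-1) => //= m /= ms.
  rewrite (le_trans (ltW (truncnS_gt _)))// ler_nat.
  by rewrite ltnS leqW.
rewrite /segment_pow/= in_itv/= sn andbT exprVn.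
by rewrite -[leRHS]invrK lef_pV2// posrE ?invr_gt0// exprn_gt0.
Unshelve. all: by end_near. Qed.

Lemma bigcup_segment_pow (p : nat) :
  \bigcup_n segment_pow p n = `]0, +oo[%classic.
Proof.
apply/seteqP; split => s.
  by case=> n _ /segment_pow_gt0; rewrite /= in_itv/= andbT.
rewrite /= in_itv/= andbT => s0.
have [n _ ns] := segment_pow_contains p _ s0.
by exists n => //; apply: ns => /=.
Qed.

(** Monotone convergence along the segments. The integrals stay extended-real, so that this can
    serve to prove integrability. *)
Lemma ge0_cvg_integral_halfline (p : nat) (f : R -> R) :
  measurable_fun (`]0, +oo[ : set R) f -> (forall s : R, 0 < s -> 0 <= f s) ->
  (\int[mu]_(s in segment_pow p n) (f s)%:E)%E @[n --> \oo] -->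
  (\int[mu]_(s in `]0%R, +oo[) (f s)%:E)%E.
Proof.
move=> mf f0; rewrite -(bigcup_segment_pow p).
apply: ge0_nondecreasing_set_cvg_integral.
- exact: segment_pow_homo.
- exact: measurable_segment_pow.
- move=> n; apply/measurable_EFinP; apply: measurable_funS mf => //.
  by move=> s /segment_pow_gt0; rewrite /= in_itv/= andbT.
- by move=> n s /segment_pow_gt0 s0; rewrite lee_fin f0.
Qed.

(** Dominated convergence for the restrictions of [f] to the segments, with |f| as the bound. *)
Lemma cvg_Rintegral_halfline (p : nat) (f : R -> R) :
  mu.-integrable `]0, +oo[ (EFin \o f) ->
  \int[mu]_(s in segment_pow p n) f s @[n --> \oo] -->
  \int[mu]_(s in `]0, +oo[) f s.
Proof.
move=> intf.
have mf : measurable_fun (`]0, +oo[ : set R) f.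
  by apply/measurable_EFinP; exact: measurable_int intf.
apply: fine_cvg; rewrite fineK; last exact: integrable_fin_num.
have sub n : segment_pow p n = `]0, +oo[%classic `&` segment_pow p n.
  apply/seteqP; split => [s sn|s []//]; split => //.
  by rewrite /= in_itv/= andbT; exact: segment_pow_gt0 sn.
have [|||||_ _ H] := @dominated_convergence _ _ _ mu _
    (measurable_itv (`]0, +oo[ : interval R))
    (fun n => (EFin \o f) \_ (segment_pow p n)) (EFin \o f) (abse \o (EFin \o f)).
- move=> n; apply/measurable_restrict => //=; first exact: measurable_segment_pow.
  by apply/measurable_EFinP; apply: measurable_funS mf => //; exact: subIsetl.
- exact/measurable_EFinP.
- apply: aeW => s /=; rewrite in_itv/= andbT => s0.
  apply: cvg_near_cst; have := segment_pow_contains p _ s0.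
  by apply: filterS => n sn; rewrite patchE mem_set.
- exact: integrable_abse.
- apply: aeW => s n s0; rewrite patchE; case: ifPn => //= _.
  by rewrite normr0 lee_fin.
apply: cvg_trans H; apply: near_eq_cvg; apply: nearW => n /=.
by rewrite [in RHS]sub integral_mkcondr.
Qed.

Lemma continuous_exprn (n : nat) : continuous (fun x : R => x ^+ n).
Proof.
move=> x; apply: differentiable_continuous; apply/derivable1_diffP.
exact: exprn_derivable.
Qed.

(** The segments are compact and stay away from 0, so regularity at positive points is enough. *)
Lemma FTC_segment_pow (p : nat) (F f : R -> R) (n : nat) :
  (forall s : R, 0 < s -> is_derive s 1 F (f s)) ->
  (forall s : R, 0 < s -> {for s, continuous f}) ->
  (\int[mu]_(s in segment_pow p n) (f s)%:E =
    (F (n.+2%:R ^+ p.+1)%R - F (n.+2%:R^-1 ^+ p.+1)%R)%:E)%E.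
Proof.
move=> dF cf; rewrite (continuous_FTC2 (F := F) (segment_pow_lt p n)) ?EFinB//.
- apply: continuous_in_subspaceT => s /set_mem/segment_pow_gt0; exact: cf.
- have cF (s : R) : 0 < s -> {for s, continuous F}.
    move=> s0; have [+ _] := dF _ s0.
    by move=> /derivable1_diffP/differentiable_continuous.
  have n0 : 0 < n.+2%:R^-1 ^+ p.+1 :> R by rewrite exprn_gt0// invr_gt0.
  split.
  + move=> s; rewrite in_itv/= => /andP[s0 _].
    by have [] := dF s (lt_trans n0 s0).
  + exact/cvg_at_right_filter/cF.
  + by apply/cvg_at_left_filter/cF; rewrite exprn_gt0.
- move=> s; rewrite in_itv/= => /andP[s0 _].
  have n0 : 0 < n.+2%:R^-1 ^+ p.+1 :> R by rewrite exprn_gt0// invr_gt0.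
  by rewrite derive1E; have [_] := dF s (lt_trans n0 s0).
Qed.

(** On each segment the integral of [f] is a difference of two values of [F] in [0, M], hence at
    most M; monotone convergence carries this bound to the half-line. *)
Lemma integrable_bounded_primitive (F f : R -> R) (M : R) :
  (forall s : R, 0 < s -> is_derive s 1 F (f s)) ->
  (forall s : R, 0 < s -> {for s, continuous f}) ->
  (forall s : R, 0 < s -> 0 <= f s) ->
  (forall s : R, 0 < s -> 0 <= F s <= M) ->
  mu.-integrable `]0, +oo[ (EFin \o f).
Proof.
move=> dF cf f0 FM.
have mf : measurable_fun (`]0, +oo[ : set R) f.
  apply: open_continuous_measurable_fun; first exact: interval_open.
  by move=> s; rewrite inE/= in_itv/= andbT => /cf.
apply/integrableP; split; first exact/measurable_EFinP.
apply: (@le_lt_trans _ _ M%:E); last exact: ltry.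
rewrite [leLHS](_ : _ = \int[mu]_(s in `]0%R, +oo[) (f s)%:E)%E; last first.
  apply: eq_integral => s; rewrite inE/= in_itv/= andbT => s0.
  by rewrite ger0_norm ?f0.
have H := ge0_cvg_integral_halfline 0 f mf f0.
apply: (cvge_to_le H); apply: nearW => n.
rewrite (FTC_segment_pow _ F)// lee_fin.
have /andP[_ h1] := FM (n.+2%:R ^+ 1) (exprn_gt0 _ (ltr0Sn _ _)).
have /andP[h2 _] := FM (n.+2%:R^-1 ^+ 1) ltac:(by rewrite exprn_gt0// invr_gt0).
lra.
Qed.

Lemma Rintegral_vanishing_primitive (F f : R -> R) :
  (forall s : R, 0 < s -> is_derive s 1 F (f s)) ->
  (forall s : R, 0 < s -> {for s, continuous f}) ->
  mu.-integrable `]0, +oo[ (EFin \o f) ->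
  F s @[s --> 0^'+] --> 0 -> F s @[s --> +oo] --> 0 ->
  \int[mu]_(s in `]0, +oo[) f s = 0.
Proof.
move=> dF cf intf F0 Fy; apply/esym.
apply: cvg_unique (cvg_Rintegral_halfline 0 _ intf) => //.
have H : F (n.+2%:R ^+ 1) - F (n.+2%:R^-1 ^+ 1) @[n --> \oo] --> (0 : R).
  rewrite -[X in _ --> X]subr0; apply: cvgB.
    apply: cvg_comp Fy; apply/cvgryPge => A; near=> n.
    rewrite expr1 (@le_trans _ _ n%:R)//; first by near: n; exact: nbhs_infty_ger.
    by rewrite ler_nat !leqW.
  apply: ((cvg_at_rightP F 0 0).1 F0) => //; split=> [n|].
    by rewrite expr1 invr_gt0.
  (* The left endpoints 1/(n+2) form the harmonic sequence shifted by one. *)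
  have := @cvg_harmonic R; rewrite -cvg_shiftS.
  by under eq_fun do rewrite /harmonic/= -[_^-1]expr1.
apply: cvg_trans H; apply: near_eq_cvg; apply: nearW => n /=.
by rewrite /Rintegral (FTC_segment_pow _ F).
Unshelve. all: by end_near. Qed.

(** The substitution s = x^(p+1) is made on compact segments, and both sides are limits of the same
    sequence. It is used with p = 1 for the weight and p = 3 for Gamma. *)
Lemma ge0_substitution_pow (p : nat) (G : R -> R) :
  (forall s : R, 0 < s -> {for s, continuous G}) ->
  (forall s : R, 0 < s -> 0 <= G s) ->
  (\int[mu]_(s in `]0%R, +oo[) (G s)%:E =
   \int[mu]_(x in `]0%R, +oo[) (G (x ^+ p.+1) * (p.+1%:R * x ^+ p))%:E)%E.
Proof.
move=> cG G0.
pose F (x : R) := x ^+ p.+1.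
have F'E : F^`()%classic = (fun x => p.+1%:R * x ^+ p).
  apply/funext => x; rewrite derive1E /F exp_derive.
  by rewrite /GRing.scale/= mulr1.
have F'c : continuous F^`()%classic.
  rewrite F'E => x; apply: cvgM; first exact: cvg_cst.
  exact: continuous_exprn.
have Fc : continuous F by move=> x; exact: continuous_exprn.
have cGF (s : R) : 0 < s ->
    {for s, continuous (fun x : R => G (x ^+ p.+1) * (p.+1%:R * x ^+ p))}.
  move=> s0; apply: cvgM; last by have := F'c s; rewrite F'E.
  apply: (@continuous_comp _ _ _ F G); first exact: Fc.
  by apply: cG; rewrite exprn_gt0.
have mc (g : R -> R) : (forall s : R, 0 < s -> {for s, continuous g}) ->
    measurable_fun (`]0%R, +oo[%classic : set R) g.
  move=> gc; apply: open_continuous_measurable_fun; first exact: interval_open.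
  by move=> s; rewrite inE/= in_itv/= andbT => /gc.
have HG := ge0_cvg_integral_halfline p G (mc _ cG) G0.
have HGF := ge0_cvg_integral_halfline 0 _ (mc _ cGF) _.
apply: cvg_unique HG _ => //; apply: cvg_trans (HGF _); last first.
  by move=> s s0; rewrite mulr_ge0 ?G0 ?exprn_gt0// mulr_ge0// exprn_ge0// ltW.
apply: near_eq_cvg; apply: nearW => n.
rewrite /segment_pow (@integration_by_substitution_increasing _ F G)//.
- by apply: eq_integral => x _; rewrite fctE F'E.
- exact: ltW (segment_pow_lt 0 n).
- move=> x y; rewrite !in_itv/= => /andP[x0 _] _ xy.
  have x0' : 0 <= x by apply: le_trans x0; rewrite invr_ge0.
  by rewrite /F ltrXn2r// nnegrE// (le_trans x0')// ltW.
- by apply/cvg_ex; eexists; apply: cvg_at_right_filter; exact: (F'c _).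
- by apply/cvg_ex; eexists; apply: cvg_at_left_filter; exact: (F'c _).
- split.
  + by move=> x _; apply: exprn_derivable.
  + by apply: cvg_at_right_filter; exact: (Fc _).
  + by apply: cvg_at_left_filter; exact: (Fc _).
- apply: continuous_in_subspaceT => s /set_mem sn; apply: cG.
  exact: segment_pow_gt0 sn.
Qed.

End Halfline.

(** * The kernel s^c exp(-s^4 + t s) *)

Section Kernel.
Context {R : realType}.
Notation mu := (@lebesgue_measure R).

Definition qkernel (c t s : R) : R := s `^ c * expR (- s ^+ 4 + t * s).

Definition phi (c t : R) : R := \int[mu]_(s in `]0, +oo[) qkernel c t s.

(** Combines s^4 >= 2 s^2 - 1 with c s <= c^2/4 + s^2. It bounds the exponents that appear once
    powers of s are replaced by exponentials. *)
Lemma linear_sub_quartic_le (c s : R) : c * s - s ^+ 4 <= 1 + c ^+ 2.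
Proof.
have : 0 <= (s ^+ 2 - 1) ^+ 2 by apply: sqr_ge0.
have : 0 <= (c / 2 - s) ^+ 2 by apply: sqr_ge0.
have : 0 <= s ^+ 2 by apply: sqr_ge0.
have : 0 <= c ^+ 2 by apply: sqr_ge0.
rewrite (_ : s ^+ 4 = s ^+ 2 ^+ 2); last by ring.
lra.
Qed.

(** From ln s <= s - 1 <= s. *)
Lemma powR_le_expR (c s : R) : 0 <= c -> 0 < s -> s `^ c <= expR (c * s).
Proof.
move=> c0 s0; rewrite /powR gt_eqF// ler_expR ler_wpM2l//.
have := @le_ln1Dx R (s - 1).
rewrite (_ : 1 + (s - 1) = s) => [H|]; last by ring.
by rewrite (le_trans (H _))//; lra.
Qed.

Lemma qkernel_ge0 (c t s : R) : 0 <= qkernel c t s.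
Proof. by rewrite mulr_ge0 ?powR_ge0 ?expR_ge0. Qed.

Lemma qkernelE (c t s : R) : qkernel c t s = qkernel c 0 s * expR (t * s).
Proof. by rewrite /qkernel mul0r addr0 -mulrA -expRD. Qed.

Lemma qkernelD (c t s : R) (n : nat) :
  0 < s -> qkernel (c + n%:R) t s = s ^+ n * qkernel c t s.
Proof.
move=> s0; rewrite /qkernel powRD; last by rewrite (gt_eqF s0) implybT.
by rewrite powR_mulrn ?ltW// -mulrA mulrCA.
Qed.

Lemma is_derive_expR_quartic (t s : R) :
  is_derive s 1 (expR \o (fun x : R => - x ^+ 4 + t * x))
    (expR (- s ^+ 4 + t * s) * (- 4 * s ^+ 3 + t)).
Proof.
have d : is_derive s 1 (fun x : R => - x ^+ 4 + t * x) (- 4 * s ^+ 3 + t).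
  apply: is_derive_eq.
  by rewrite /GRing.scale/= !mulr1; ring.
by apply: is_derive_eq; rewrite /GRing.scale/=; ring.
Qed.

(** Written with all powers of s absorbed into the parameter, so that integration yields a relation
    between values of [phi]. *)
Lemma is_derive_qkernel (c t s : R) : 0 < s ->
  is_derive s 1 (qkernel (c + 1) t)
    ((c + 1) * qkernel c t s + t * qkernel (c + 1) t s - 4 * qkernel (c + 4) t s).
Proof.
move=> s0.
have d1 := is_derive1_powR (c + 1) s0.
have d3 := is_derive_expR_quartic t s.
have := is_deriveM d1 d3; rewrite /GRing.scale/=.
move/is_derive_eq; apply.
rewrite (_ : c + 1 - 1 = c); last by ring.
rewrite (qkernelD _ _ _ 1%N s0) (qkernelD _ _ _ 4%N s0) /qkernel.
rewrite (powRD (r := c) (s := 1)); last by rewrite (gt_eqF s0) implybT.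
rewrite powRr1 ?ltW//.
by ring.
Qed.

Lemma continuous_qkernel (c t s : R) : 0 < s -> {for s, continuous (qkernel c t)}.
Proof.
move=> s0; have [+ _] := is_derive_qkernel (c - 1) t s s0.
by rewrite subrK => /derivable1_diffP/differentiable_continuous.
Qed.

Lemma measurable_qkernel (c t : R) : measurable_fun setT (qkernel c t).
Proof.
apply: measurable_funM; first exact: measurable_powR.
apply: measurableT_comp => //; apply: measurable_funD.
  by apply: measurableT_comp => //; exact: measurable_funX.
by apply: measurable_funM.
Qed.

Lemma integrable_qkernel (c t : R) : -1 < c ->
  mu.-integrable `]0, +oo[ (EFin \o qkernel c t).
Proof.
move=> c1.
have c1' : 0 < c + 1 by lra.
(* The kernel is dominated by the derivative of the bounded function
   (s / (1 + s))^(c+1), namely (c + 1) s^c (1 + s)^(-c-2). *)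
pose g (s : R) := 1 - (1 + s)^-1.
pose f (s : R) := (c + 1) * g s `^ c * (1 + s) ^- 2.
have g0 (s : R) : 0 < s -> 0 < g s.
  by move=> s0; rewrite /g subr_gt0 invf_lt1; lra.
have dg (s : R) : 0 < s -> is_derive s 1 g ((1 + s) ^- 2).
  move=> s0; have s1 : 1 + s != 0 by lra.
  by apply: is_derive_eq; rewrite /GRing.scale/=; ring.
have dF (s : R) : 0 < s -> is_derive s 1 (fun x : R => g x `^ (c + 1)) (f s).
  move=> s0; have h1 := dg _ s0.
  have h2 := is_derive1_powR (c + 1) (g0 _ s0).
  have := is_derive1_comp h2 h1.
  by rewrite /= (_ : c + 1 - 1 = c); last by ring.
have cf (s : R) : 0 < s -> {for s, continuous f}.
  move=> s0; have s1 : 1 + s != 0 by lra.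
  have h3 : derivable f s 1.
    have h4 : is_derive s 1 (fun x : R => g x `^ c) (c * g s `^ (c - 1) * (1 + s) ^- 2).
      exact: is_derive1_comp (is_derive1_powR c (g0 _ s0)) (dg _ s0).
    have h5 : derivable (fun x : R => (1 + x) ^- 2) s 1.
      apply: (@derivableV _ _ (fun x : R => (1 + x) ^+ 2)).
        exact: expf_neq0.
      exact: ex_derive.
    have h6 : derivable (fun x : R => (c + 1) * g x `^ c) s 1.
      have [h4' _] := h4.
      exact: (derivableM (derivable_cst (c + 1) s 1) h4').
    exact: (derivableM h6 h5).
  by move/derivable1_diffP : h3 => /differentiable_continuous.
have f0 (s : R) : 0 < s -> 0 <= f s.
  by move=> s0; rewrite /f !mulr_ge0 ?powR_ge0 ?invr_ge0 ?exprn_ge0//; lra.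
have intf : mu.-integrable `]0, +oo[ (EFin \o f).
  apply: (integrable_bounded_primitive (fun x : R => g x `^ (c + 1)) f 1 dF cf f0).
  move=> s s0; rewrite powR_ge0/= -[leRHS](powRr0 (g s)).
  have g1 : g s <= 1 by rewrite /g lerBlDr lerDl invr_ge0; lra.
  by apply: ger_powR; rewrite ?g1 ?g0 ?(ltW c1').
(* [K] bounds (1 + s)^(c+2) exp(-s^4 + t s) / (c + 1): the power is at most exp((c + 2)(1 + s)), and
   [linear_sub_quartic_le] at c + 2 + t bounds the rest of the exponent. *)
pose K := expR ((c + 2) + (1 + (c + 2 + t) ^+ 2)) / (c + 1).
have K0 : 0 <= K by rewrite /K divr_ge0 ?expR_ge0// ltW.
have mI : measurable (`]0, +oo[ : set (measurableTypeR R)) by exact: measurable_itv.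
apply: (@le_integrable _ _ R mu _ mI _ (EFin \o (fun s => K * f s))).
- by apply/measurable_EFinP; apply: measurable_funTS; exact: measurable_qkernel.
- move=> s; rewrite /= in_itv/= andbT => s0.
  rewrite lee_fin !ger0_norm ?qkernel_ge0 ?(mulr_ge0 K0 (f0 _ s0))//.
  have s1 : 0 < 1 + s by lra.
  have sE : s = g s * (1 + s) by rewrite /g; field; lra.
  have kE : s `^ c = g s `^ c * (1 + s) `^ c.
    by rewrite -powRM ?(ltW (g0 _ s0)) ?ltW// -sE.
  rewrite /qkernel kE /f /K.
  rewrite [leRHS](_ : _ = g s `^ c * ((1 + s) ^- 2 *
    expR ((c + 2) + (1 + (c + 2 + t) ^+ 2)))); last by field; lra.
  rewrite -mulrA ler_wpM2l ?powR_ge0//.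
  rewrite [leRHS]mulrC ler_pdivlMr ?exprn_gt0//.
  rewrite mulrAC -powR_mulrn ?(ltW s1)// -powRD; last first.
    by rewrite (gt_eqF s1) implybT.
  have h := powR_le_expR (c + 2) (1 + s) ltac:(lra) s1.
  apply: (le_trans (ler_wpM2r _ h)); rewrite ?expR_ge0// -expRD ler_expR.
  have := linear_sub_quartic_le (c + 2 + t) s; lra.
- exact: (integrableZl mI K intf).
Qed.

Lemma qkernel_cvgr0 (c t : R) : 0 < c -> qkernel c t s @[s --> 0^'+] --> 0.
Proof.
move=> c0; rewrite -[X in _ --> X](mul0r (expR (- 0 ^+ 4 + t * 0))).
apply: cvgM; first exact: powR_cvg0.
apply: cvg_at_right_filter.
have [+ _] := is_derive_expR_quartic t 0.
by move=> /derivable1_diffP/differentiable_continuous.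
Qed.

Lemma qkernel_cvgy0 (c t : R) : 0 <= c -> qkernel c t s @[s --> +oo] --> 0.
Proof.
move=> c0.
(* With s^c <= exp(c s), the exponent c s + t s - s^4 is at most 1 + (c + t + 1)^2 - s. *)
pose K := expR (1 + (c + t + 1) ^+ 2).
apply: (@squeeze_cvgr _ _ _ _ (cst 0) (fun s => K * expR (- s))).
- near=> s; rewrite qkernel_ge0/= /qkernel.
  have s0 : 0 < s by near: s; exact: nbhs_pinfty_gt.
  apply: (le_trans (ler_wpM2r _ (powR_le_expR c s c0 s0))); rewrite ?expR_ge0//.
  rewrite /K -!expRD ler_expR.
  have := linear_sub_quartic_le (c + t + 1) s; lra.
- exact: cvg_cst.
- rewrite -[X in _ --> X](mulr0 K); apply: cvgMl_tmp; exact: cvgr_expR.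
Unshelve. all: by end_near. Qed.

(** Integrates the derivative of [qkernel (c + 1) t]; its boundary value at 0 vanishes because c + 1
    > 0. *)
Lemma phi_recurrence (c t : R) : -1 < c ->
  4 * phi (c + 4) t = (c + 1) * phi c t + t * phi (c + 1) t.
Proof.
move=> c1.
have mI : measurable (`]0, +oo[ : set (measurableTypeR R)) by exact: measurable_itv.
have i0 := integrable_qkernel c t c1.
have i1 := integrable_qkernel (c + 1) t ltac:(lra).
have i4 := integrable_qkernel (c + 4) t ltac:(lra).
have iZ k d : mu.-integrable `]0, +oo[ (EFin \o qkernel d t) ->
    mu.-integrable `]0, +oo[ (EFin \o (fun s => k * qkernel d t s)).
  by move=> /(integrableZl mI k).
have iD : mu.-integrable `]0, +oo[
    (EFin \o (fun s => (c + 1) * qkernel c t s + t * qkernel (c + 1) t s)).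
  exact: (integrableD mI (iZ _ _ i0) (iZ _ _ i1)).
pose f s := (c + 1) * qkernel c t s + t * qkernel (c + 1) t s - 4 * qkernel (c + 4) t s.
have iB : mu.-integrable `]0, +oo[ (EFin \o f).
  exact: (integrableB mI iD (iZ 4 _ i4)).
have cf (s : R) : 0 < s -> {for s, continuous f}.
  move=> s0; apply: cvgB; [apply: cvgD|]; apply: cvgMl_tmp; exact: continuous_qkernel.
have k0 : qkernel (c + 1) t s @[s --> 0^'+] --> 0 by apply: qkernel_cvgr0; lra.
have ky : qkernel (c + 1) t s @[s --> +oo] --> 0 by apply: qkernel_cvgy0; lra.
have := Rintegral_vanishing_primitive (qkernel (c + 1) t) f
  (is_derive_qkernel c t) cf iB k0 ky.
rewrite /f RintegralB//; last exact: iZ.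
rewrite RintegralD//; [|exact: iZ..].
rewrite !RintegralZl// => H; rewrite /phi; apply/esym/eqP.
by rewrite -subr_eq0; apply/eqP/H.
Qed.

(** Adding the endpoint 0, a null set, does not change the integral. *)
Lemma integrable_qkernel_cy (c t : R) : -1 < c ->
  mu.-integrable `[0, +oo[ (EFin \o qkernel c t).
Proof.
move=> c1; have /integrableP[_ fin] := integrable_qkernel c t c1.
apply/integrableP; split.
  by apply/measurable_EFinP; apply: measurable_funTS; exact: measurable_qkernel.
rewrite -integral_itv_obnd_cbnd//.
apply: measurableT_comp => //; apply/measurable_EFinP; apply: measurable_funTS.
exact: measurable_qkernel.
Qed.

Lemma Rintegral_qkernel_cy (c t : R) : -1 < c ->
  phi c t = \int[mu]_(s in `[0, +oo[) qkernel c t s.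
Proof.
by move=> c1; rewrite /phi Rintegral_itv_obnd_cbnd//; exact: integrable_qkernel.
Qed.

End Kernel.

(** * Power series expansion in t *)

Section PhiSeries.
Context {R : realType}.
Notation mu := (@lebesgue_measure R).

(** The Taylor coefficients of [phi c] at t = 0. *)
Definition phi_coeff (c : R) (n : nat) : R := phi (c + n%:R) 0 / n`!%:R.

(** The integrand with exp(t s) replaced by its truncated series, each s^i being absorbed into the
    parameter of the kernel. *)
Let partial (c t : R) (n : nat) (s : R) : R :=
  \sum_(0 <= i < n) (i`!%:R^-1 * t ^+ i) * qkernel (c + i%:R) 0 s.

Let integral_partial (c t : R) (n : nat) : -1 < c ->
  mu.-integrable `]0, +oo[ (EFin \o partial c t n) /\
  \int[mu]_(s in `]0, +oo[) partial c t n s =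
    pseries (phi_coeff c) t n.
Proof.
move=> c1.
have mI : measurable (`]0, +oo[ : set (measurableTypeR R)) by exact: measurable_itv.
elim: n => [|n [intn IHn]].
  have -> : partial c t 0 = cst 0.
    by apply/funext => s; rewrite /partial big_nil.
  split; first exact: integrable0.
  by rewrite Rintegral_cst// mul0r /pseries /series/= big_nil.
have -> : partial c t n.+1 =
    (fun s => partial c t n s + (n`!%:R^-1 * t ^+ n) * qkernel (c + n%:R) 0 s).
  by apply/funext => s; rewrite /partial big_nat_recr.
have ik : mu.-integrable `]0, +oo[ (EFin \o qkernel (c + n%:R) 0).
  by apply: integrable_qkernel; rewrite (lt_le_trans c1)// lerDl.
have ikZ : mu.-integrable `]0, +oo[
    (EFin \o (fun s => (n`!%:R^-1 * t ^+ n) * qkernel (c + n%:R) 0 s)).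
  exact: (integrableZl mI _ ik).
split; first exact: (integrableD mI intn ikZ).
rewrite RintegralD// IHn RintegralZl// /pseries /series/= big_nat_recr//=.
by congr (_ + _); rewrite /phi_coeff /phi [LHS]mulrC mulrA.
Qed.

Let partialE (c t : R) (n : nat) (s : R) : 0 < s ->
  partial c t n s = qkernel c 0 s * series (exp_coeff (t * s)) n.
Proof.
move=> s0; rewrite /partial /series/= big_distrr/=; apply: eq_bigr => i _.
by rewrite qkernelD// /exp_coeff/= exprMn; field; rewrite pnatr_eq0 -lt0n fact_gt0.
Qed.

Lemma series_exp_coeff_le (x : R) (n : nat) : 0 <= x ->
  series (exp_coeff x) n <= expR x.
Proof.
move=> x0; apply: nondecreasing_cvgn_le; last exact: is_cvg_series_exp_coeff.
by apply: nondecreasing_series => i _ _; exact: exp_coeff_ge0.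
Qed.

(** Term-by-term integration by dominated convergence: the partial sums of exp(t s) are bounded by
    exp(|t| s), so [qkernel c |t|] dominates. *)
Lemma cvg_phi_series (c t : R) : -1 < c ->
  pseries (phi_coeff c) t @ \oo --> phi c t.
Proof.
move=> c1.
have mI : measurable (`]0, +oo[ : set (measurableTypeR R)) by exact: measurable_itv.
have [|||||ik _ H] := @dominated_convergence _ _ _ mu _ mI
  (fun n => EFin \o partial c t n) (EFin \o qkernel c t) (EFin \o qkernel c `|t|).
- by move=> n; have [+ _] := integral_partial c t n c1; exact: measurable_int.
- by apply/measurable_EFinP; apply: measurable_funTS; exact: measurable_qkernel.
- apply: aeW => s /=; rewrite in_itv/= andbT => s0.
  apply: cvg_EFin; first exact: nearW.
  rewrite qkernelE; apply: (@cvg_trans _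
    (qkernel c 0 s * series (exp_coeff (t * s)) n @[n --> \oo])).
    by apply: near_eq_cvg; apply: nearW => n /=; rewrite partialE.
  by apply: cvgMl_tmp; exact: is_cvg_series_exp_coeff.
- exact: integrable_qkernel.
- apply: aeW => s n /=; rewrite in_itv/= andbT => s0.
  rewrite lee_fin partialE// (qkernelE c `|t|) normrM ger0_norm ?qkernel_ge0//.
  rewrite ler_wpM2l ?qkernel_ge0//.
  apply: le_trans (series_exp_coeff_le _ n _); last by rewrite mulr_ge0// ltW.
  rewrite /series/= (le_trans (ler_norm_sum _ _ _))//; apply: ler_sum => i _.
  by rewrite /exp_coeff/= normrM normrX normrM normfV (gtr0_norm s0) normr_nat.
have Hfin : fine (\int[mu]_(s in `]0%R, +oo[) (EFin \o partial c t n) s)%E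
    @[n --> \oo] --> phi c t.
  by apply: fine_cvg; rewrite fineK//; exact: integrable_fin_num.
apply: cvg_trans Hfin; apply: near_eq_cvg; apply: nearW => n /=.
by have [_ <-] := integral_partial c t n c1.
Qed.

Lemma phiE (c t : R) : -1 < c -> phi c t = limn (pseries (phi_coeff c) t).
Proof. by move=> c1; apply/esym/cvg_lim => //; exact: cvg_phi_series. Qed.

(** The factor n + 1 turns (n+1)! into n!, so formal differentiation only raises c by one. *)
Lemma pseries_diffs_phi_coeff (c : R) :
  pseries_diffs (phi_coeff c) = phi_coeff (c + 1).
Proof.
apply/funext => n; rewrite /pseries_diffs /phi_coeff factS natrM.
rewrite -addrA nat1r; field.
by rewrite nat1r !pnatr_eq0 -lt0n fact_gt0.
Qed.

Lemma is_derive_phi (c t : R) : -1 < c -> is_derive t 1 (phi c) (phi (c + 1) t).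
Proof.
move=> c1.
have c11 : -1 < c + 1 by lra.
have c12 : -1 < c + 1 + 1 by lra.
have -> : phi c = fun t => limn (pseries (phi_coeff c) t).
  by apply/funext => x; exact: phiE.
rewrite phiE// -pseries_diffs_phi_coeff.
(* Termwise differentiation needs the series and its first two formal derivatives to converge at a
   point beyond |t|; all three are series of [phi], with parameters c, c + 1 and c + 2. *)
apply: (@pseries_snd_diffs _ _ (`|t| + 1)).
- by apply/cvg_ex; eexists; exact: cvg_phi_series.
- by rewrite pseries_diffs_phi_coeff; apply/cvg_ex; eexists; exact: cvg_phi_series.
- by rewrite !pseries_diffs_phi_coeff; apply/cvg_ex; eexists; exact: cvg_phi_series.
- by rewrite (@ger0_norm _ (_ + _)) ?addr_ge0// ltrDl.
Qed.

End PhiSeries.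

(** * Reduction of the weight and of Gamma to the kernel *)

Section GammaOmega.
Context {R : realType}.
Notation mu := (@lebesgue_measure R).

Lemma measurable_oppr :
  measurable_fun [set: measurableTypeR R]
    (-%R : measurableTypeR R -> measurableTypeR R).
Proof. exact: oppr_measurable. Qed.

(** By uniqueness of Lebesgue measure it suffices to compare on intervals ]a, b], whose preimage is
    [-b, -a[. *)
Lemma lebesgue_measure_opp (A : set (measurableTypeR R)) : measurable A ->
  pushforward mu (-%R : measurableTypeR R -> measurableTypeR R) A = mu A.
Proof.
move=> mA; apply/esym.
pose m : measure (measurableTypeR R) R :=
  measure_function_pushforward__canonical__measure_function_Measure mu
    measurable_oppr.
apply: (@lebesgue_measure_unique R m) => //.
move=> X [[a b] _ <-].
rewrite /m/= /pushforward.
rewrite (_ : _ @^-1` _ = `[- b, - a[%classic); last first.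
  apply/seteqP; split => x; rewrite /= !in_itv/=; lra.
rewrite !lebesgue_measure_itv/= !lte_fin ltrN2.
by case: ifPn => // ab; rewrite -!EFinB opprK addrC.
Qed.

Lemma integral_reflect (f : R -> \bar R) (D : set R) :
  measurable D -> measurable_fun D f -> (forall x, D x -> (0 <= f x)%E) ->
  (\int[mu]_(x in D) f x = \int[mu]_(x in -%R @^-1` D) f (- x)%R)%E.
Proof.
move=> mD mf f0.
rewrite -(ge0_integral_pushforward measurable_oppr mu mD mf); last first.
  by move=> x /set_mem; exact: f0.
by apply: eq_measure_integral => A mA _; exact/esym/lebesgue_measure_opp.
Qed.

(** Reflection gives I = -I for the integral I, which is finite. This removes the first moment of
    the weight. *)
Lemma integral_odd (f : R -> R) : mu.-integrable setT (EFin \o f) ->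
  (forall x, f (- x) = - f x) -> (\int[mu]_x (f x)%:E = 0)%E.
Proof.
move=> intf fN.
have H : (\int[mu]_x (f x)%:E = \int[mu]_x (f (- x))%:E)%E.
  have := @integral_pushforward _ _ _ _ _ _ measurable_oppr mu setT (EFin \o f).
  rewrite preimage_setT => <-//.
  - by apply: eq_measure_integral => A mA _; exact/esym/lebesgue_measure_opp.
  - exact: measurable_int intf.
  - rewrite (_ : _ \o _ = (fun x => - (EFin \o f) x)%E); last first.
      by apply/funext => x; rewrite /= fN EFinN.
    exact: integrableN.
have fin : (\int[mu]_x (f x)%:E)%E \is a fin_num by exact: integrable_fin_num intf.
move: H; under [RHS]eq_integral do rewrite fN EFinN.
rewrite integralN; last exact: integrable_add_def intf.
move: fin; case: (\int[mu]_x (f x)%:E)%E => // r _ [] /= rr.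
congr EFin; lra.
Qed.

Lemma omega_opp (c t x : R) : omega c t (- x) = omega c t x.
Proof.
by rewrite /omega normrN sqrrN (_ : (- x) ^+ 8 = x ^+ 8) //; ring.
Qed.

Lemma omega_ge0 (c t x : R) : 0 <= omega c t x.
Proof. by rewrite mulr_ge0 ?powR_ge0 ?expR_ge0. Qed.

Lemma measurable_omega (c t : R) : measurable_fun setT (omega c t).
Proof.
apply: measurable_funM.
  by apply: (measurableT_comp (measurable_powR _)).
apply: measurableT_comp => //; apply: measurable_funD.
  by apply: measurableT_comp => //; exact: measurable_funX.
by apply: measurable_funM => //; exact: measurable_funX.
Qed.

(** The integrand after s = x^2, ds = 2x dx; the factor 2 accounts for the two halves of the real
    line. *)
Lemma omega_qkernel (c t x : R) : 0 < x ->
  qkernel c t (x ^+ 2) * (2 * x) = 2 * omega c t x.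
Proof.
move=> x0; rewrite /qkernel /omega (gtr0_norm x0) -!exprM.
rewrite powRD ?(gt_eqF x0) ?implybT// powRr1 ?ltW//.
rewrite powRrM powR_mulrn ?ltW//; ring.
Qed.

(** The line is split at 0, the negative half reflected, and s = x^2 substituted. The equality is
    extended-real, so integrability of the weight follows from that of the kernel. *)
Lemma integral_omega (c t : R) :
  (\int[mu]_x (omega c t x)%:E = \int[mu]_(s in `]0%R, +oo[) (qkernel c t s)%:E)%E.
Proof.
have mo : measurable_fun setT (EFin \o omega c t).
  by apply/measurable_EFinP; exact: measurable_omega.
have mpos : measurable (`]0%R, +oo[ : set (measurableTypeR R)) by exact: measurable_itv.
have mneg : measurable (`]-oo, 0%R] : set (measurableTypeR R)) by exact: measurable_itv.
have TE : [set: R] = `]-oo, 0%R] `|` `]0%R, +oo[.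
  by rewrite -(setUv `]-oo, 0%R]) setCitvl.
rewrite TE ge0_integral_setU//=; first last.
- apply/disj_setPS => x []; rewrite /= !in_itv/= andbT; lra.
- by move=> x _; rewrite lee_fin omega_ge0.
- exact: measurable_funTS.
(* Dropping the endpoint 0 makes the reflected interval exactly ]0, +oo[. *)
rewrite -integral_itv_bndo_bndc; last exact: measurable_funTS.
rewrite integral_reflect//; last 2 first.
- exact: measurable_funTS.
- by move=> x _; rewrite lee_fin omega_ge0.
rewrite (_ : -%R @^-1` _ = `]0, +oo[%classic); last first.
  by apply/seteqP; split => x; rewrite /= !in_itv/= andbT oppr_lt0.
under eq_integral do rewrite omega_opp.
rewrite (ge0_substitution_pow 1 (qkernel c t)); first last.
- by move=> s _; exact: qkernel_ge0.
- by move=> s; exact: continuous_qkernel.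
rewrite -ge0_integralD//.
- apply: eq_integral => x; rewrite inE/= in_itv/= andbT => x0.
  by rewrite expr1 omega_qkernel// -EFinD mulr2n mulrDl mul1r.
- by move=> x _; rewrite lee_fin omega_ge0.
- exact: measurable_funTS.
- by move=> x _; rewrite lee_fin omega_ge0.
- exact: measurable_funTS.
Qed.

Lemma integrable_omega (c t : R) : -1 < c ->
  mu.-integrable setT (EFin \o omega c t).
Proof.
move=> c1; apply/integrableP; split.
  by apply/measurable_EFinP; exact: measurable_omega.
under eq_integral do rewrite /= ger0_norm ?omega_ge0//.
rewrite integral_omega.
have /integrableP[_] := integrable_qkernel c t c1.
by under eq_integral do rewrite /= ger0_norm ?qkernel_ge0//.
Qed.

Lemma mu0E (c t : R) : mu0 c t = phi c t.
Proof. by rewrite /mu0 /Rintegral integral_omega. Qed.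

(** Substituting s = x^4 turns s^(a-1) ds into 4 x^(4a-1) dx. *)
Lemma GammaE (a : R) : 0 < a -> Gamma a = 4 * phi (4 * a - 1) 0.
Proof.
move=> a0.
pose g (s : R) := s `^ (a - 1) * expR (- s).
have mg : measurable_fun [set: measurableTypeR R] g.
  apply: measurable_funM; first exact: measurable_powR.
  by apply: measurableT_comp => //; exact: oppr_measurable.
rewrite /phi -RintegralZl//; last by apply: integrable_qkernel; lra.
rewrite /Gamma /Rintegral -integral_itv_obnd_cbnd; last first.
  by apply/measurable_EFinP; exact: measurable_funTS mg.
rewrite (ge0_substitution_pow 3 g); first last.
- by move=> s _; rewrite mulr_ge0 ?powR_ge0 ?expR_ge0.
- move=> s s0; apply: differentiable_continuous; apply/derivable1_diffP.
  apply: derivableM; first by apply: derivable_powR; rewrite in_itv/= andbT.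
  exact: ex_derive.
congr fine; apply: eq_integral => x; rewrite inE/= in_itv/= andbT => x0.
congr EFin; rewrite /g /qkernel mul0r addr0.
have x0' := ltW x0.
have -> : (x ^+ 4) `^ (a - 1) = x `^ (4 * (a - 1)) by rewrite -powR_mulrn// -powRrM.
rewrite (_ : 4 * a - 1 = 4 * (a - 1) + 3%:R); last by ring.
rewrite powRD; last by rewrite (gt_eqF x0) implybT.
by rewrite powR_mulrn//; ring.
Qed.

End GammaOmega.

(** * Hypergeometric form *)

Section Hypergeometric.
Context {R : realType}.

Lemma series_mul4 (f : R ^nat) (n : nat) :
  series f (4 * n)%N = series (fun k => f (4 * k + 0)%N) n +
    series (fun k => f (4 * k + 1)%N) n + series (fun k => f (4 * k + 2)%N) n +
    series (fun k => f (4 * k + 3)%N) n.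
Proof.
rewrite /series/=; elim: n => [|n IHn]; first by rewrite muln0 !big_nil !addr0.
rewrite mulnS addnC !addnS addn0 !big_nat_recr//= IHn addn0 !addnS !addn0.
ring.
Qed.

Lemma limn_seriesZ (C : R) (f : R ^nat) :
  cvgn (series (fun k => C * f k)) ->
  limn (series (fun k => C * f k)) = C * limn (series f).
Proof.
have E g : series (fun k => C * g k) = (fun n => C * series g n).
  by apply/funext => n; rewrite /series/= big_distrr.
(* For C = 0 the convergence hypothesis says nothing about [series f], but both sides are 0. *)
rewrite E; have [->|C0] := eqVneq C 0.
  by move=> _; rewrite mul0r; under eq_fun do rewrite mul0r; rewrite lim_cst.
move=> H; have cf : cvgn (series f).
  have -> : series f = (fun n => C^-1 * (C * series f n)).
    by apply/funext => n; rewrite mulKf.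
  exact: is_cvgMl_tmp.
by apply: cvg_lim => //; exact: cvgMl_tmp.
Qed.

Lemma phi_ge0 (c t : R) : 0 <= phi c t.
Proof. by apply: Rintegral_ge0 => s _; exact: qkernel_ge0. Qed.

Lemma phi_coeff_ge0 (c : R) (n : nat) : 0 <= phi_coeff c n.
Proof. by rewrite divr_ge0 ?phi_ge0. Qed.

(** The terms are nonnegative, and the partial sums are bounded by those of the full series at a
    larger point. *)
Lemma is_cvg_phi_coeff_mul4 (c t : R) (j : nat) : -1 < c -> (j < 4)%N ->
  cvgn (series (fun k => phi_coeff c (4 * k + j)%N * (t ^+ 4) ^+ k)).
Proof.
move=> c1 j4.
(* As r >= 1 and r >= |t|, t^(4k) <= r^(4k) <= r^(4k+j), which restores the missing power. *)
pose r := 1 + `|t|.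
have t4 : 0 <= t ^+ 4 by rewrite (_ : 4 = (2 * 2))%N// exprM sqr_ge0.
have r0 : 0 <= r by rewrite addr_ge0.
pose f n := phi_coeff c n * r ^+ n.
have f0 n : 0 <= f n by rewrite mulr_ge0 ?phi_coeff_ge0 ?exprn_ge0.
have s0 i n : 0 <= series (fun k => f (4 * k + i)%N) n.
  by rewrite /series/= sumr_ge0.
have le_phi n : series f n <= phi c r.
  rewrite phiE//; apply: nondecreasing_cvgn_le.
    by apply: nondecreasing_series => i _ _; exact: f0.
  by apply/cvg_ex; eexists; exact: cvg_phi_series.
have le_f n : series (fun k => f (4 * k + j)%N) n <= phi c r.
  apply: le_trans (le_phi (4 * n)%N); rewrite series_mul4.
  have := s0 0 n; have := s0 1 n; have := s0 2 n; have := s0 3 n.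
  by case: j j4 => [|[|[|[|//]]]] _; lra.
apply: nondecreasing_is_cvgn.
  apply: nondecreasing_series => i _ _.
  by rewrite mulr_ge0 ?phi_coeff_ge0 ?(exprn_ge0 _ t4).
exists (phi c r) => _ [n _ <-]; apply: le_trans (le_f n).
rewrite /series/=; apply: ler_sum => k _; rewrite /f ler_wpM2l ?phi_coeff_ge0//.
rewrite -exprM -[t ^+ (4 * k)]ger0_norm; last by rewrite exprM exprn_ge0.
rewrite normrX (@le_trans _ _ (r ^+ (4 * k)))//.
  by rewrite lerXn2r// ?nnegrE// lerDr.
by rewrite ler_weXn2l ?leq_addr// lerDl.
Qed.

Lemma phi_mul4 (c t : R) : -1 < c ->
  let S j := limn (series (fun k => phi_coeff c (4 * k + j)%N * (t ^+ 4) ^+ k)) in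
  phi c t = S 0 + t * S 1 + t ^+ 2 * S 2 + t ^+ 3 * S 3.
Proof.
move=> c1 S.
have cS j : (j < 4)%N ->
    series (fun k => phi_coeff c (4 * k + j)%N * (t ^+ 4) ^+ k) @ \oo --> S j.
  by move=> j4; exact: is_cvg_phi_coeff_mul4.
(* Along multiples of 4 the partial sums split exactly into the four residue classes. *)
have H1 : pseries (phi_coeff c) t (4 * n)%N @[n --> \oo] --> phi c t.
  apply: cvg_comp (cvg_phi_series c t c1) => A [N _ NA]; exists N => // n /= Nn.
  by apply: NA => /=; rewrite (leq_trans Nn)// leq_pmull.
apply: cvg_unique H1 _ => //.
have E j n : series (fun k => phi_coeff c (4 * k + j)%N * t ^+ (4 * k + j)) n =
    t ^+ j * series (fun k => phi_coeff c (4 * k + j)%N * (t ^+ 4) ^+ k) n.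
  rewrite /series/= big_distrr/=; apply: eq_bigr => k _.
  by rewrite exprD exprM; ring.
rewrite (_ : (fun n => _) = (fun n =>
    series (fun k => phi_coeff c (4 * k + 0)%N * (t ^+ 4) ^+ k) n +
    t * series (fun k => phi_coeff c (4 * k + 1)%N * (t ^+ 4) ^+ k) n +
    t ^+ 2 * series (fun k => phi_coeff c (4 * k + 2)%N * (t ^+ 4) ^+ k) n +
    t ^+ 3 * series (fun k => phi_coeff c (4 * k + 3)%N * (t ^+ 4) ^+ k) n)); last first.
  by apply/funext => n; rewrite /pseries series_mul4 !E expr0 mul1r expr1.
by do 3 (apply: cvgD; last by apply: cvgMl_tmp; exact: cS); exact: cS.
Qed.

Lemma pochhammerS (a : R) (k : nat) :
  pochhammer a k.+1 = pochhammer a k * (a + k%:R).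
Proof. by rewrite /pochhammer big_ord_recr. Qed.

Lemma pochhammer_gt0 (a : R) (k : nat) : 0 < a -> 0 < pochhammer a k.
Proof. by move=> a0; apply: prodr_gt0 => i _; rewrite ltr_wpDr. Qed.

(** The ratio of coefficients four apart is rational in k. The last hypothesis factors the quotient
    of their factorials: one factor is 4(x + 1), which yields k!, and the other three yield the
    lower parameters. *)
Lemma phi_coeff_pochhammer (c b1 b2 b3 : R) (j k : nat) : -1 < c ->
  0 < b1 -> 0 < b2 -> 0 < b3 ->
  (forall x : R, (4 * x + j%:R + 1) * (4 * x + j%:R + 2) * (4 * x + j%:R + 3) *
     (4 * x + j%:R + 4) = 256 * ((x + 1) * (b1 + x) * (b2 + x) * (b3 + x))) ->
  phi_coeff c (4 * k + j) = phi_coeff c j *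
    (pochhammer ((c + j%:R + 1) / 4) k /
      (pochhammer b1 k * pochhammer b2 k * pochhammer b3 k) *
      ((256^-1) ^+ k / k`!%:R)).
Proof.
move=> c1 b10 b20 b30 Hj.
have b_gt0 := (pochhammer_gt0 _ k b10, pochhammer_gt0 _ k b20, pochhammer_gt0 _ k b30).
elim: k {b_gt0} => [|k IHk].
  by rewrite muln0 add0n /pochhammer !big_ord0 expr0 fact0; field.
have nk x y (n : nat) : 0 < x -> y = x + n%:R :> R -> y != 0.
  by move=> x0 ->; rewrite gt_eqF// ltr_wpDr.
have cjk : -1 < c + (4 * k + j)%:R by rewrite (lt_le_trans c1)// lerDl.
(* The numerator comes from [phi_recurrence] at t = 0, the denominator from the four new factors of
   the factorial. *)
have rec : phi_coeff c (4 * k.+1 + j) = phi_coeff c (4 * k + j) *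
    ((c + j%:R + 1) / 4 + k%:R) /
    (256 * ((k%:R + 1) * (b1 + k%:R) * (b2 + k%:R) * (b3 + k%:R))).
  rewrite -Hj /phi_coeff.
  have -> : (4 * k.+1 + j = (4 * k + j).+4)%N by rewrite mulnS -addnA addnC !addnS addn0.
  have -> : phi (c + (4 * k + j).+4%:R) 0 =
      (c + (4 * k + j)%:R + 1) / 4 * phi (c + (4 * k + j)%:R) 0.
    have := phi_recurrence _ 0 cjk; rewrite mul0r addr0 -addrA -natrD addn4 => H.
    by rewrite mulrAC -H mulrC mulKf.
  rewrite !factS !natrM natrD natrM.
  rewrite -[in LHS](natr1 (4 * k + j).+3) -[in LHS](natr1 (4 * k + j).+2).
  rewrite -[in LHS](natr1 (4 * k + j).+1) -[in LHS](natr1 (4 * k + j)).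
  rewrite natrD natrM.
  have f0 : ((4 * k + j)`!%:R : R) != 0 by rewrite pnatr_eq0 -lt0n fact_gt0.
  have k0 : 0 <= k%:R :> R by [].
  have j0 : 0 <= j%:R :> R by [].
  field; rewrite f0 /=; repeat (apply/andP; split); lra.
rewrite rec IHk !pochhammerS factS natrM exprS -natr1.
have k0 : 0 <= k%:R :> R by [].
have f0 : (k`!%:R : R) != 0 by rewrite pnatr_eq0 -lt0n fact_gt0.
have p1 := lt0r_neq0 (pochhammer_gt0 _ k b10).
have p2 := lt0r_neq0 (pochhammer_gt0 _ k b20).
have p3 := lt0r_neq0 (pochhammer_gt0 _ k b30).
field; rewrite f0 p1 p2 p3 /=; repeat (apply/andP; split); lra.
Qed.

(** The leading coefficient is a Gamma value by [GammaE] with 4a - 1 = c + j, and 256^(-k) is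
    absorbed since (t/4)^4 = t^4/256. *)
Lemma phi_mul4_hyp1F3 (c t b1 b2 b3 : R) (j : nat) : -1 < c -> (j < 4)%N ->
  0 < b1 -> 0 < b2 -> 0 < b3 ->
  (forall x : R, (4 * x + j%:R + 1) * (4 * x + j%:R + 2) * (4 * x + j%:R + 3) *
     (4 * x + j%:R + 4) = 256 * ((x + 1) * (b1 + x) * (b2 + x) * (b3 + x))) ->
  limn (series (fun k => phi_coeff c (4 * k + j)%N * (t ^+ 4) ^+ k)) =
    Gamma ((c + j%:R + 1) / 4) / (4 * j`!%:R) *
      hyp1F3 ((c + j%:R + 1) / 4) b1 b2 b3 ((t / 4) ^+ 4).
Proof.
move=> c1 j4 b10 b20 b30 Hj.
have j0 : 0 <= j%:R :> R by [].
have -> : Gamma ((c + j%:R + 1) / 4) / (4 * j`!%:R) = phi_coeff c j.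
  rewrite GammaE; last by lra.
  rewrite /phi_coeff (_ : 4 * _ - 1 = c + j%:R); last by field.
  by field; rewrite pnatr_eq0 -lt0n fact_gt0.
have cvg := is_cvg_phi_coeff_mul4 c t j c1 j4.
have E : (fun k => phi_coeff c (4 * k + j)%N * (t ^+ 4) ^+ k) =
   (fun k => phi_coeff c j * (pochhammer ((c + j%:R + 1) / 4) k /
      (pochhammer b1 k * pochhammer b2 k * pochhammer b3 k) *
      (((t / 4) ^+ 4) ^+ k / k`!%:R))).
  apply/funext => k; rewrite (phi_coeff_pochhammer c b1 b2 b3)//.
  have -> : (t / 4) ^+ 4 = t ^+ 4 * 256^-1 by field.
  rewrite [in RHS](exprMn _ (t ^+ 4)).
  by move: (pochhammer _ _ / _) (_^-1 ^+ k) (_ ^+ 4 ^+ k) => u v w; ring.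
by move: cvg; rewrite E => cvg; rewrite limn_seriesZ.
Qed.

(** For residue j the lower parameters are (j+1)/4, ..., (j+4)/4 with the value 1 omitted, and the
    prefactor is t^j / (4 j!). *)
Lemma phi_hyp1F3 (c t : R) : -1 < c ->
  phi c t =
      1 / 4 * Gamma (c / 4 + 1 / 4) *
        hyp1F3 (c / 4 + 1 / 4) (1 / 4) (1 / 2) (3 / 4) ((t / 4) ^+ 4)
    + 1 / 4 * t * Gamma (c / 4 + 1 / 2) *
        hyp1F3 (c / 4 + 1 / 2) (1 / 2) (3 / 4) (5 / 4) ((t / 4) ^+ 4)
    + 1 / 8 * t ^+ 2 * Gamma (c / 4 + 3 / 4) *
        hyp1F3 (c / 4 + 3 / 4) (3 / 4) (5 / 4) (3 / 2) ((t / 4) ^+ 4)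
    + 1 / 24 * t ^+ 3 * Gamma (c / 4 + 1) *
        hyp1F3 (c / 4 + 1) (5 / 4) (3 / 2) (7 / 4) ((t / 4) ^+ 4).
Proof.
move=> c1; rewrite (phi_mul4 c t c1).
have h0 := phi_mul4_hyp1F3 c t (1 / 4) (1 / 2) (3 / 4) 0 c1 erefl
  ltac:(by rewrite divr_gt0) ltac:(by rewrite divr_gt0)
  ltac:(by rewrite divr_gt0) ltac:(by move=> x; field).
have h1 := phi_mul4_hyp1F3 c t (1 / 2) (3 / 4) (5 / 4) 1 c1 erefl
  ltac:(by rewrite divr_gt0) ltac:(by rewrite divr_gt0)
  ltac:(by rewrite divr_gt0) ltac:(by move=> x; field).
have h2 := phi_mul4_hyp1F3 c t (3 / 4) (5 / 4) (3 / 2) 2 c1 erefl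
  ltac:(by rewrite divr_gt0) ltac:(by rewrite divr_gt0)
  ltac:(by rewrite divr_gt0) ltac:(by move=> x; field).
have h3 := phi_mul4_hyp1F3 c t (5 / 4) (3 / 2) (7 / 4) 3 c1 erefl
  ltac:(by rewrite divr_gt0) ltac:(by rewrite divr_gt0)
  ltac:(by rewrite divr_gt0) ltac:(by move=> x; field).
rewrite h0 h1 h2 h3.
rewrite (_ : (c + 0%:R + 1) / 4 = c / 4 + 1 / 4); last by field.
rewrite (_ : (c + 1%:R + 1) / 4 = c / 4 + 1 / 2); last by field.
rewrite (_ : (c + 2%:R + 1) / 4 = c / 4 + 3 / 4); last by field.
rewrite (_ : (c + 3%:R + 1) / 4 = c / 4 + 1); last by field.
rewrite fact0 (_ : 1`! = 1)%N// (_ : 2`! = 2)%N// (_ : 3`! = 6)%N//.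
by congr (_ + _ + _ + _); move: (Gamma _) (hyp1F3 _ _ _ _ _) => g y; field.
Qed.

End Hypergeometric.

(** * The recurrence coefficient *)

Section Recurrence.
Context {R : realType}.
Notation mu := (@lebesgue_measure R).

Lemma derive1n_phi (c : R) (k : nat) : -1 < c ->
  derive1n k (phi c) = phi (c + k%:R).
Proof.
move=> c1; elim: k => [|k IHk]; first by rewrite addr0.
apply/funext => t; rewrite derive1nS IHk derive1E.
have ck : -1 < c + k%:R by rewrite (lt_le_trans c1)// lerDl.
by have [_ ->] := is_derive_phi _ t ck; rewrite -addrA natr1.
Qed.

Lemma sqr_omega (c t x : R) : -1 < c -> x ^+ 2 * omega c t x = omega (c + 1) t x.
Proof.
move=> c1; rewrite /omega mulrA; congr (_ * _).
have [->|x0] := eqVneq x 0.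
  (* At x = 0 the exponent 2c + 3 must be nonzero, because a zero power of 0 is 1. *)
  rewrite expr0n mul0r normr0 powR0//; apply/eqP; lra.
rewrite (_ : 2 * (c + 1) + 1 = 2%:R + (2 * c + 1)); last by ring.
rewrite (powRD (r := 2%:R)); last by rewrite normr_eq0 x0 implybT.
by rewrite powR_mulrn// real_normK ?num_real.
Qed.

(** Since |x| <= 1 + x^2, the sum of the weights for c and c + 1 dominates. *)
Lemma integrable_mul_omega (c t : R) : -1 < c ->
  mu.-integrable setT (EFin \o (fun x => x * omega c t x)).
Proof.
move=> c1.
have i0 := integrable_omega c t c1.
have i1 := integrable_omega (c + 1) t ltac:(lra).
have iD : mu.-integrable setT (EFin \o (fun x => omega c t x + omega (c + 1) t x)).
  exact: (integrableD measurableT i0 i1).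
apply: le_integrable iD => //.
- apply/measurable_EFinP; apply: measurable_funM => //.
  exact: measurable_omega.
- move=> x _; rewrite lee_fin normrM (ger0_norm (omega_ge0 _ _ _)).
  rewrite (ger0_norm (addr_ge0 (omega_ge0 _ _ _) (omega_ge0 _ _ _))).
  rewrite -sqr_omega// -[X in _ <= X + _]mul1r -mulrDl ler_wpM2r ?omega_ge0//.
  have : 0 <= (`|x| - 1) ^+ 2 by exact: sqr_ge0.
  have y0 : 0 <= `|x| by [].
  rewrite -[x ^+ 2]real_normK ?num_real//.
  by move: (`|x|) y0 => y y0 H; nra.
Qed.

(** Here P_0 = 1 and P_1 = x + a. Orthogonality of P_1 to P_0 and parity give a = 0; then P_2 = x^2
    - b, and its orthogonality to P_0 determines b. *)
Lemma recurrence_coeffE (c t b : R) (P : nat -> {poly R}) : -1 < c ->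
  monic_orthogonal (omega c t) P -> P 2%N = 'X * P 1%N - b *: P 0%N ->
  0 < phi c t /\ b = phi (c + 1) t / phi c t.
Proof.
move=> c1 [Pm [h [h0 Ph]]] P2.
have [mP0 sP0] := Pm 0%N; have [mP1 sP1] := Pm 1%N.
have P0E x : (P 0%N).[x] = 1.
  rewrite horner_coef sP0 big_ord1 expr0 mulr1.
  by have := monicP mP0; rewrite lead_coefE sP0.
pose a := (P 1%N)`_0.
have P1E x : (P 1%N).[x] = x + a.
  rewrite horner_coef sP1 big_ord_recl big_ord1 expr0 mulr1 /= expr1 addrC.
  by have := monicP mP1; rewrite lead_coefE sP1/= => ->; rewrite mul1r.
have i0 := integrable_omega c t c1.
have i1 := integrable_mul_omega c t c1.
have i2 := integrable_omega (c + 1) t ltac:(lra).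
have iZ k f : mu.-integrable setT (EFin \o f) ->
    mu.-integrable setT (EFin \o (fun x => k * f x)).
  by move=> /(integrableZl measurableT k).
have I0 : \int[mu]_x omega c t x = phi c t by exact: mu0E.
have I1 : \int[mu]_x (x * omega c t x) = 0.
  rewrite /Rintegral integral_odd// => x.
  by rewrite omega_opp mulNr.
have I2 : \int[mu]_x omega (c + 1) t x = phi (c + 1) t by exact: mu0E.
(* This integral is the squared norm [h 0] of P_0, positive by hypothesis. *)
have phi0 : 0 < phi c t.
  have := Ph 0%N 0%N; rewrite eqxx => /(congr1 fine)/= H.
  rewrite -I0 (_ : \int[mu]_x _ = h 0%N)// -H; apply: eq_Rintegral => x _.
  by rewrite P0E !mul1r.
have a0 : a = 0.
  have := Ph 1%N 0%N => /(congr1 fine)/= H.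
  have : \int[mu]_x (x * omega c t x + a * omega c t x) = 0.
    rewrite -[RHS]H; apply: eq_Rintegral => x _.
    by rewrite P1E P0E mulr1 mulrDl.
  rewrite RintegralD//; last exact: iZ.
  rewrite RintegralZl// I0 I1 add0r => /eqP.
  by rewrite mulf_eq0 (gt_eqF phi0) orbF => /eqP.
split=> //.
have := Ph 2%N 0%N => /(congr1 fine)/= H.
have : \int[mu]_x (omega (c + 1) t x - b * omega c t x) = 0.
  rewrite -[RHS]H; apply: eq_Rintegral => x _.
  rewrite P2 hornerD hornerN hornerZ hornerM hornerX P1E !P0E a0 -(sqr_omega _ _ _ c1).
  by ring.
rewrite RintegralB//; last exact: iZ.
rewrite RintegralZl// I0 I2 => /eqP; rewrite subr_eq0 => /eqP ->.
by rewrite mulfK// gt_eqF.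
Qed.

(** The quotient rule, with differentiation of [phi] raising its parameter by one. *)
Lemma is_derive_phi_ratio (c t : R) (k : nat) : -1 < c -> phi c t != 0 ->
  let r k x := phi (c + k%:R) x / phi c x in
  is_derive t 1 (r k) (r k.+1 t - r k t * r 1%N t).
Proof.
move=> c1 p0 r.
have ck : -1 < c + k%:R by rewrite (lt_le_trans c1)// lerDl.
have d1 := is_derive_phi _ t ck.
have d0 := is_derive_phi _ t c1.
have dV := is_deriveV p0 d0.
have := is_deriveM d1 dV => /is_derive_eq; apply.
rewrite /r /GRing.scale/= -natr1 addrA mulr1n.
by move: (phi _ t) (phi _ t) (phi _ t) (phi _ t) p0 => a0 a1 a2 a3 ?; field.
Qed.

(* The hypothesis holds for r k := f^(k) / f; then b is the logarithmic
   derivative of f and the left-hand side expresses f^(4) / f through b. *)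
Lemma fourth_ratio (r : nat -> R -> R) (t : R) :
  (forall k (x : R), is_derive x 1 (r k) (r k.+1 x - r k x * r 1%N x)) ->
  let b := r 1%N in
  (forall k : nat, (k < 3)%N -> derivable (derive1n k b) t 1) /\
  derive1n 3 b t + 4 * b t * derive1n 2 b t + 3 * (derive1 b t) ^+ 2
    + 6 * (b t) ^+ 2 * derive1 b t + (b t) ^+ 4 = r 4 t.
Proof.
move=> dr b.
have d0 (x : R) : is_derive x 1 b (r 2%N x - b x ^+ 2).
  by rewrite expr2; exact: dr.
have E1 : b^`()%classic = (fun x => r 2%N x - b x ^+ 2).
  by apply/funext => x; rewrite derive1E; have [_] := d0 x.
have d1 (x : R) : is_derive x 1 (fun x => r 2%N x - b x ^+ 2)
    (r 3%N x - 3 * b x * r 2%N x + 2 * b x ^+ 3).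
  have h2 := dr 2%N x; rewrite -/b in h2; have h1 := d0 x.
  apply: is_derive_eq; rewrite /GRing.scale/=.
  by move: (b x) (r _ x) (r _ x) => ? ? ?; ring.
have E2 : derive1n 2 b = (fun x => r 3%N x - 3 * b x * r 2%N x + 2 * b x ^+ 3).
  by apply/funext => x; rewrite derive1nS derive1n1 E1 derive1E; have [_] := d1 x.
have d2 (x : R) : is_derive x 1
    (fun x => r 3%N x - 3 * b x * r 2%N x + 2 * b x ^+ 3)
    (r 4%N x - 4 * b x * r 3%N x - 3 * r 2%N x ^+ 2
      + 12 * b x ^+ 2 * r 2%N x - 6 * b x ^+ 4).
  have h1 := d0 x; have h2 := dr 2%N x; have h3 := dr 3%N x; rewrite -/b in h2 h3.
  apply: is_derive_eq; rewrite /GRing.scale/=.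
  by move: (b x) (r 2%N x) (r 3%N x) (r 4%N x) => ? ? ? ?; ring.
split.
  case=> [|[|[|//]]] _.
  - by have [] := d0 t.
  - by rewrite derive1n1 E1; have [] := d1 t.
  - by rewrite E2; have [] := d2 t.
(* If the r_k are read as moments, b and its derivatives are the cumulants, and the identity is the
   fourth moment written in cumulants. *)
rewrite (derive1nS _ 2) E2 E1 derive1E; have [_ ->] := d2 t.
by move: (b t) (r 2%N t) (r 3%N t) (r 4%N t) => ? ? ? ?; ring.
Qed.

(** Dividing [phi_recurrence] by 4 phi(c, t) gives r_4 = (c + 1)/4 + t b/4, to be inserted in
    [fourth_ratio]. *)
Lemma phi_ratio_ode (c : R) : -1 < c -> (forall t, phi c t != 0) ->
  let b t := phi (c + 1) t / phi c t in
  forall t,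
  (forall k : nat, (k < 3)%N -> derivable (derive1n k b) t 1) /\
  derive1n 3 b t + 4 * b t * derive1n 2 b t + 3 * (derive1 b t) ^+ 2
    + 6 * (b t) ^+ 2 * derive1 b t + (b t) ^+ 4 - 1 / 4 * t * b t
  = 1 / 4 * (c + 1).
Proof.
move=> c1 p0 b t.
pose r k x := phi (c + k%:R) x / phi c x.
have bE : b = r 1%N by rewrite /b /r mulr1n.
have [H1 H2] := fourth_ratio r t (fun k x => is_derive_phi_ratio c x k c1 (p0 x)).
rewrite bE; split => //; rewrite H2 -bE /b /r.
have := phi_recurrence c t c1; move: (p0 t).
move: (phi (c + 4) t) (phi (c + 1) t) (phi c t) => x4 x1 x x0 H.
have -> : x4 = 4^-1 * (4 * x4) by rewrite mulKf.
by rewrite H; field.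
Qed.

End Recurrence.

Theorem lemma5p1 (R : realType) (lambda : R) (hlambda : -1 < lambda) :
  (forall t : R,
    [/\ (@lebesgue_measure R).-integrable setT (EFin \o omega lambda t),
        (@lebesgue_measure R).-integrable `[0, +oo[
          (fun s : R => (s `^ lambda * expR (- s ^+ 4 + t * s))%:E),
        mu0 lambda t =
          \int[@lebesgue_measure R]_(s in `[0, +oo[)
            (s `^ lambda * expR (- s ^+ 4 + t * s)) &
        mu0 lambda t =
            1 / 4 * Gamma (lambda / 4 + 1 / 4) *
              hyp1F3 (lambda / 4 + 1 / 4) (1 / 4) (1 / 2) (3 / 4)
                ((t / 4) ^+ 4)
          + 1 / 4 * t * Gamma (lambda / 4 + 1 / 2) *
              hyp1F3 (lambda / 4 + 1 / 2) (1 / 2) (3 / 4) (5 / 4)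
                ((t / 4) ^+ 4)
          + 1 / 8 * t ^+ 2 * Gamma (lambda / 4 + 3 / 4) *
              hyp1F3 (lambda / 4 + 3 / 4) (3 / 4) (5 / 4) (3 / 2)
                ((t / 4) ^+ 4)
          + 1 / 24 * t ^+ 3 * Gamma (lambda / 4 + 1) *
              hyp1F3 (lambda / 4 + 1) (5 / 4) (3 / 2) (7 / 4)
                ((t / 4) ^+ 4)])
  /\
  (forall t : R,
    (forall k : nat, (k < 4)%N -> derivable (derive1n k (mu0 lambda)) t 1) /\
    derive1n 4 (mu0 lambda) t - 1 / 4 * t * derive1 (mu0 lambda) t
      - 1 / 4 * (lambda + 1) * mu0 lambda t = 0)
  /\
  (forall (P : R -> nat -> {poly R}) (beta1 : R -> R),
    (forall t : R, monic_orthogonal (omega lambda t) (P t)) ->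
    (forall t : R, P t 2%N = 'X * P t 1%N - beta1 t *: P t 0%N) ->
    forall t : R,
      [/\ is_derive t 1 (fun u : R => ln (mu0 lambda u)) (beta1 t),
          forall k : nat, (k < 3)%N -> derivable (derive1n k beta1) t 1 &
          derive1n 3 beta1 t + 4 * beta1 t * derive1n 2 beta1 t
            + 3 * (derive1 beta1 t) ^+ 2
            + 6 * (beta1 t) ^+ 2 * derive1 beta1 t
            + (beta1 t) ^+ 4 - 1 / 4 * t * beta1 t
          = 1 / 4 * (lambda + 1)]).
Proof.
have mu0_phi : mu0 lambda = phi lambda by apply/funext => t; exact: mu0E.
have dphi (k : nat) (t : R) : derivable (phi (lambda + k%:R)) t 1.
  have ck : -1 < lambda + k%:R by rewrite (lt_le_trans hlambda)// lerDl.
  by have [] := is_derive_phi _ t ck.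
split; last split.
- move=> t.
  have intc := integrable_qkernel_cy lambda t hlambda.
  split.
  + exact: integrable_omega.
  + exact: intc.
  + by rewrite mu0E; exact: Rintegral_qkernel_cy.
  + by rewrite mu0E phi_hyp1F3.
- move=> t; rewrite mu0_phi; split.
    by move=> k _; rewrite derive1n_phi.
  rewrite -derive1n1 !derive1n_phi// mulr1n.
  have := phi_recurrence lambda t hlambda; lra.
- move=> P beta1 Pm P2.
  have H t := recurrence_coeffE lambda t (beta1 t) (P t) hlambda (Pm t) (P2 t).
  (* Orthogonality is available for every t, so [beta1] equals the ratio as a function and its
     derivatives can be taken. *)
  have phi0 t : phi lambda t != 0 by rewrite gt_eqF//; have [] := H t.
  have beta1E : beta1 = fun t => phi (lambda + 1) t / phi lambda t.
    by apply/funext => t; have [] := H t.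
  move=> t; have [H1 H2] := phi_ratio_ode lambda hlambda phi0 t.
  split; rewrite ?beta1E//.
  rewrite mu0_phi mulrC; have [p0 _] := H t.
  exact: is_derive1_comp (is_derive1_ln p0) (is_derive_phi _ t hlambda).
Qed.
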